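(* Let $L$ be a first-order language (without equality) and let $\Phi$ be an $L$-formula $$\Phi:=\forall y_0\,\exists x_1\,\forall y_1\cdots\exists x_k\,\forall y_k\,\varphi(y_0,x_1,y_1,\dots,x_k,y_k),$$ where $\varphi$ is quantifier-free. Then $\Phi$ is logically valid if and only if there is a depth $k$ Herbrand game tree $T$ with a winning strategy for Student for $\varphi$.
   Context: All trees are finite and rooted. The displayed variables are all the variables of $\varphi$. **Totally ordered tree.** A tree with a total order $\prec$ on the set of all its nodes such that $u\prec v$ whenever $v$ is a child of $u$. Its nodes are enumerated $u_0\prec u_1\prec\cdots\prec u_{n-1}$ ($u_0$ is the root), and the order is extended to edges by $u_0\prec e_1\prec u_1\prec e_2\prec u_2\prec\cdots\prec e_{n-1}\prec u_{n-1}$, where $e_i$ is the edge connecting $u_i$ with its parent. **Herbrand game tree of depth $k$.** A labeled totally ordered tree with all branches of length $k$ where (1) the nodes are labeled by distinct free variables; (2) the edges are labeled by terms of $L$ such that a term on an edge $e$ can only contain free variables that are labels of nodes preceding $e$ in the $\prec$ ordering; (3) for every node, the outgoing edges have different labels. **Winning strategy.** For a depth $k$ totally ordered tree $T$ with nodes labeled by distinct variables, a strategy for Student is any labeling of the edges satisfying the conditions of a Herbrand game tree. It is a winning strategy for $\varphi$ if, with $b$ ranging over the branches of $T$ and $z_{b_0},t_{b_1},z_{b_1},\dots,t_{b_k},z_{b_k}$ being the successive labels of the nodes and edges of $b$ from root to leaf, the disjunction $$\bigvee_b\varphi(z_{b_0},t_{b_1},z_{b_1},\dots,t_{b_k},z_{b_k})$$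 is a (propositional) tautology. *)

(* Defs.v *)
From mathcomp Require Import all_boot.

Set Implicit Arguments.
Unset Strict Implicit.
Unset Printing Implicit Defensive.

Record language := Language {
  fsym : Type;
  farity : fsym -> nat;
  rsym : Type;
  rarity : rsym -> nat
}.

Notation var := nat.

(* Arguments are finite functions on 'I_n, so that equality of terms is
   syntactic identity without function extensionality. *)
Inductive term (L : language) : Type :=
| Var of var
| App (f : fsym L) of {ffun 'I_(farity f) -> term L}.

Arguments Var {L} _.
Arguments App {L} _ _.

Inductive formula (L : language) : Type :=
| Bot
| Rel (r : rsym L) of {ffun 'I_(rarity r) -> term L}
| Not of formula L
| And of formula L & formula L
| Or of formula L & formula L
| Imp of formula L & formula L
| All of var & formula L
| Ex of var & formula L.

Arguments Bot {L}.
Arguments Rel {L} _ _.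

Section Syntax.
Variable L : language.

Fixpoint tvars (t : term L) : seq var :=
  match t with
  | Var x => [:: x]
  | App f ts => flatten [seq tvars (ts i) | i <- enum 'I_(farity f)]
  end.

Fixpoint fvars (F : formula L) : seq var :=
  match F with
  | Bot => [::]
  | Rel r ts => flatten [seq tvars (ts i) | i <- enum 'I_(rarity r)]
  | Not A => fvars A
  | And A B | Or A B | Imp A B => fvars A ++ fvars B
  | All x A | Ex x A => [seq v <- fvars A | v != x]
  end.

Fixpoint quantifier_free (F : formula L) : bool :=
  match F with
  | Bot | Rel _ _ => true
  | Not A => quantifier_free A
  | And A B | Or A B | Imp A B => quantifier_free A && quantifier_free B
  | All _ _ | Ex _ _ => false
  end.

Fixpoint tsubst (s : var -> term L) (t : term L) : term L :=
  match t with
  | Var x => s x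
  | App f ts => App f [ffun i => tsubst s (ts i)]
  end.

Definition update (D : Type) (e : var -> D) (x : var) (d : D) : var -> D :=
  fun v => if v == x then d else e v.

(* Simultaneous substitution for the free variables.  Bound variables are not
   renamed: it is only meaningful here for quantifier-free formulas. *)
Fixpoint subst (s : var -> term L) (F : formula L) : formula L :=
  match F with
  | Bot => Bot
  | Rel r ts => Rel r [ffun i => tsubst s (ts i)]
  | Not A => Not (subst s A)
  | And A B => And (subst s A) (subst s B)
  | Or A B => Or (subst s A) (subst s B)
  | Imp A B => Imp (subst s A) (subst s B)
  | All x A => All x (subst (update s x (Var x)) A)
  | Ex x A => Ex x (subst (update s x (Var x)) A)
  end.

(* A truth assignment [v] is read only at the prime formulas, i.e. the atomic
   ones and those starting with a quantifier. *)
Fixpoint peval (v : formula L -> bool) (F : formula L) : bool :=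
  match F with
  | Bot => false
  | Not A => ~~ peval v A
  | And A B => peval v A && peval v B
  | Or A B => peval v A || peval v B
  | Imp A B => peval v A ==> peval v B
  | Rel _ _ | All _ _ | Ex _ _ => v F
  end.

Definition tautology (F : formula L) : Prop := forall v, peval v F.

End Syntax.

Record structure (L : language) := Structure {
  dom :> Type;
  dom_inhabited : inhabited dom;
  fint : forall f : fsym L, {ffun 'I_(farity f) -> dom} -> dom;
  rint : forall r : rsym L, {ffun 'I_(rarity r) -> dom} -> Prop
}.

Section Semantics.
Variables (L : language) (M : structure L).

Fixpoint teval (e : var -> M) (t : term L) : M :=
  match t with
  | Var x => e x
  | App f ts => fint [ffun i => teval e (ts i)]
  end.

Fixpoint sat (e : var -> M) (F : formula L) : Prop :=
  match F with
  | Bot => False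
  | Rel r ts => rint [ffun i => teval e (ts i)]
  | Not A => ~ sat e A
  | And A B => sat e A /\ sat e B
  | Or A B => sat e A \/ sat e B
  | Imp A B => sat e A -> sat e B
  | All x A => forall d : M, sat (update e x d) A
  | Ex x A => exists d : M, sat (update e x d) A
  end.

End Semantics.

Definition valid (L : language) (F : formula L) : Prop :=
  forall (M : structure L) (e : var -> M), sat e F.

(* The quantified variables after y0 are given as the pairs (x_i, y_i). *)
Definition prenex (L : language) (y0 : var) (xy : seq (var * var))
    (phi : formula L) : formula L :=
  All y0 (foldr (fun p F => Ex p.1 (All p.2 F)) phi xy).

Definition prefix_vars (y0 : var) (xy : seq (var * var)) : seq var :=
  y0 :: flatten [seq [:: p.1; p.2] | p <- xy].

Record rooted_tree := RootedTree {
  node : finType;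
  root : node;
  child : rel node; (* [child u v]: v is a child of u *)
  root_no_parent : forall u, ~~ child u root;
  parent_unique : forall u v w, child u w -> child v w -> u = v;
  root_connected : forall u, connect child root u
}.

Arguments root : clear implicits.

Record ordered_tree := OrderedTree {
  tree :> rooted_tree;
  prec : rel (node tree);
  prec_irr : irreflexive prec;
  prec_trans : transitive prec;
  prec_total : forall u v, u != v -> prec u v || prec v u;
  prec_child : forall u v, child u v -> prec u v
}.

Definition edge (T : rooted_tree) : finType :=
  {p : node T * node T | child p.1 p.2}.

Section Trees.
Variable T : rooted_tree.

Definition src (e : edge T) : node T := (val e).1.
Definition tgt (e : edge T) : node T := (val e).2.

Definition leaf (u : node T) : bool := [forall v, ~~ child u v].

(* Branches are given by their successive edges. *)
Fixpoint branch_from (u : node T) (b : seq (edge T)) : bool :=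
  if b is e :: b' then (src e == u) && branch_from (tgt e) b' else leaf u.

Definition branch (b : seq (edge T)) : bool := branch_from (root T) b.

Definition has_depth (k : nat) : Prop := forall b, branch b -> size b = k.

End Trees.

Section Game.
Variables (L : language) (T : ordered_tree).

(* The order extended to edges: an edge comes immediately before its lower
   endpoint. *)
Definition lower (a : node T + edge T) : node T :=
  match a with inl u => u | inr e => tgt e end.

Definition is_edge (a : node T + edge T) : bool :=
  if a is inr _ then true else false.

Definition ext_prec (a b : node T + edge T) : bool :=
  prec (lower a) (lower b) ||
  [&& lower a == lower b, is_edge a & ~~ is_edge b].

Variables (z : node T -> var) (t : edge T -> term L).

Definition strategy : Prop :=
  (forall e x, x \in tvars (t e) ->
     exists2 u, ext_prec (inl u) (inr e) & x = z u) /\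
  (forall e e', src e = src e' -> e <> e' -> t e <> t e').

Definition herbrand_game_tree (k : nat) : Prop :=
  [/\ has_depth T k, injective z & strategy].

Definition branch_labels (b : seq (edge T)) : seq (term L) :=
  Var (z (root T)) :: flatten [seq [:: t e; Var (z (tgt e))] | e <- b].

Definition instance (vs : seq var) (phi : formula L) (b : seq (edge T)) :
    formula L :=
  subst (fun v => nth (Var v) (branch_labels b) (index v vs)) phi.

Definition winning (k : nat) (vs : seq var) (phi : formula L) : Prop :=
  tautology (\big[@Or L/Bot]_(b : k.-tuple (edge T) | branch b)
               instance vs phi b).

End Game.

(* Main.v *)
From HB Require Import structures.
From mathcomp Require Import all_boot zify boolp classical_sets filter.
Require Import Defs.

Set Implicit Arguments.
Unset Strict Implicit.
Unset Printing Implicit Defensive.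

(* Soundness of a winning strategy: if Phi fails in M, Opponent has answers in
   M falsifying phi on every play.  The node variables are evaluated along
   [prec]: the value at a node is Opponent's answer to the values of the edge
   labels leading to it, which only involve earlier nodes.  All branches of T
   are then false in M, so their disjunction is no tautology.

   Completeness: in the Skolemized Herbrand universe, where Opponent's answer
   to the moves q is the term Sk q, every finite set s of plays generates a
   Herbrand game tree, whose nodes are the positions of these plays and those
   occurring in their terms, ordered by the size of the terms Sk q.  If no tree
   wins, each of these trees has an assignment v_s falsifying all its branches.
   An ultrafilter on the finite sets s, containing { s | p in s } for every
   play p, turns the v_s into a structure on the Herbrand universe where
   Opponent wins every play with the answers Sk q, so that Phi fails. *)

(** * Truth assignments, evaluation and substitution *)

Lemma term_nested_ind (L : language) (P : term L -> Prop) :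
  (forall x, P (Var x)) ->
  (forall (f : fsym L) (ts : {ffun 'I_(farity f) -> term L}),
     (forall i, P (ts i)) -> P (App f ts)) ->
  forall t, P t.
Proof.
move=> PVar PApp; fix IH 1 => -[x|f ts]; first exact: PVar.
by apply: PApp => i; apply: IH.
Qed.

(** Prime formulas include the quantified ones, so truth in a structure is itself a truth
    assignment; hence tautologies hold in every structure. *)
Lemma peval_sat (L : language) (M : structure L) (e : var -> M) (F : formula L) :
  peval (fun A => `[< sat e A >]) F <-> sat e F.
Proof.
elim: F => //=.
- by move=> r ts; split => /asboolP.
- by move=> A IH; rewrite -IH; split => /negP.
- by move=> A IHA B IHB; rewrite -IHA -IHB; split => /andP.
- by move=> A IHA B IHB; rewrite -IHA -IHB; split => /orP.
- by move=> A IHA B IHB; rewrite -IHA -IHB; split => /implyP.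
- by move=> x A _; split => /asboolP.
- by move=> x A _; split => /asboolP.
Qed.

Lemma peval_big_or (L : language) (v : formula L -> bool) (I : finType)
    (P : pred I) (F : I -> formula L) :
  peval v (\big[@Or L/Bot]_(i | P i) F i) = [exists (i | P i), peval v (F i)].
Proof.
rewrite (big_morph (peval v) (id1 := false) (op1 := orb)) // big_orE.
by apply: eq_existsb => i.
Qed.

Lemma eq_teval (L : language) (M : structure L) (rho rho' : var -> M)
    (s : term L) :
  {in tvars s, rho =1 rho'} -> teval rho s = teval rho' s.
Proof.
elim/term_nested_ind: s => [x|f ts IH] /= H; first by apply: H; rewrite inE.
congr (fint _); apply/ffunP => i; rewrite !ffunE; apply: IH => x xi.
apply: H; apply/flatten_mapP; exists i => //; exact: mem_enum.
Qed.

Lemma eq_sat (L : language) (M : structure L) (F : formula L)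
    (rho rho' : var -> M) : quantifier_free F ->
  {in fvars F, rho =1 rho'} -> sat rho F <-> sat rho' F.
Proof.
elim: F => //=.
- move=> r ts _ H; suff -> : [ffun i => teval rho (ts i)] =
                             [ffun i => teval rho' (ts i)] by [].
  apply/ffunP => i; rewrite !ffunE; apply: eq_teval => x xi.
  apply: H; apply/flatten_mapP; exists i => //; exact: mem_enum.
- by move=> A IH qf H; rewrite IH.
- move=> A IHA B IHB /andP[qA qB] H.
  by rewrite IHA ?IHB // => x xP; apply: H; rewrite mem_cat xP ?orbT.
- move=> A IHA B IHB /andP[qA qB] H.
  by rewrite IHA ?IHB // => x xP; apply: H; rewrite mem_cat xP ?orbT.
- move=> A IHA B IHB /andP[qA qB] H.
  by rewrite IHA ?IHB // => x xP; apply: H; rewrite mem_cat xP ?orbT.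
Qed.

Lemma teval_tsubst (L : language) (M : structure L) (e : var -> M)
    (s : var -> term L) (t : term L) :
  teval e (tsubst s t) = teval (fun v => teval e (s v)) t.
Proof.
elim/term_nested_ind: t => //= f ts IH; congr (fint _).
by apply/ffunP => i; rewrite !ffunE IH.
Qed.

Lemma sat_subst (L : language) (M : structure L) (e : var -> M)
    (s : var -> term L) (F : formula L) : quantifier_free F ->
  sat e (subst s F) <-> sat (fun v => teval e (s v)) F.
Proof.
elim: F => //=.
- move=> r ts _; set a := finfun _; set b := finfun _.
  suff -> : a = b by [].
  by apply/ffunP => i; rewrite !ffunE teval_tsubst.
- by move=> A IH /IH->.
- by move=> A IHA B IHB /andP[/IHA-> /IHB->].
- by move=> A IHA B IHB /andP[/IHA-> /IHB->].
- by move=> A IHA B IHB /andP[/IHA-> /IHB->].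
Qed.

(** * Plays and strategies of Opponent *)

Section Play.
Variable D : Type.
Implicit Types (e : var -> D) (g : seq D -> D) (l m : seq D).

Definition assign e (vs : seq var) l : var -> D :=
  fun v => nth (e v) l (index v vs).

(* The moves [m] of Student, each followed by the answer [g] gives to the moves
   made so far; the first label of a branch, [g [::]], is not included. *)
Fixpoint play g m : seq D :=
  if m is a :: m' then [:: a, g [:: a] & play (fun q => g (a :: q)) m'] else [::].

Lemma eq_play g g' m : g =1 g' -> play g m = play g' m.
Proof.
by elim: m g g' => //= a m IH g g' gg'; rewrite gg' (IH _ (fun q => g' (a :: q))).
Qed.

Lemma size_play g m : size (play g m) = (size m).*2.
Proof. by elim: m g => //= a m IH g; rewrite IH. Qed.

(** Since [x] is not in [vs], its index there is the length of [l], so the left side reads its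
    default, the updated value [a]. *)
Lemma assign_cons e x vs a l : x \notin vs -> size l = size vs ->
  assign (update e x a) vs l = assign e (x :: vs) (a :: l).
Proof.
move=> xvs sl; apply/funext => v; rewrite /assign /update /= eq_sym.
case: eqP => [<-|//]; rewrite nth_default // sl leqNgt index_mem.
by rewrite (negPf xvs).
Qed.

End Play.

Section Falsification.
Variables (L : language) (M : structure L) (phi : formula L).

Definition pair_vars (xy : seq (var * var)) :=
  flatten [seq [:: p.1; p.2] | p <- xy].

Lemma size_pair_vars xy : size (pair_vars xy) = (size xy).*2.
Proof. by elim: xy => //= p xy ->. Qed.

(** By choice, the counterexamples become Skolem functions of the negated formula. A single [g]
    packs them all, the length of its argument telling the round. *)
Lemma not_sat_quantified (xy : seq (var * var)) (e : var -> M) :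
  uniq (pair_vars xy) ->
  ~ sat e (foldr (fun p F => Ex p.1 (All p.2 F)) phi xy) <->
  exists g, forall m, size m = size xy ->
    ~ sat (assign e (pair_vars xy) (play g m)) phi.
Proof.
elim: xy e => [|[x y] xy IH] e /=.
  have E : assign e [::] [::] = e by apply/funext.
  split=> [nphi|[g /(_ [::])]]; last by rewrite E; apply.
  have [d] := dom_inhabited M.
  by exists (fun=> d) => -[|//] _; rewrite E.
move=> /and3P[xP yP uxy]; rewrite -/(pair_vars xy) in yP *.
have E a b g m : size m = size xy ->
    assign (update (update e x a) y b) (pair_vars xy) (play g m) =
    assign e [:: x, y & pair_vars xy] [:: a, b & play g m].
  move=> sm; have sp : size (play g m) = size (pair_vars xy).
    by rewrite size_play size_pair_vars sm.
  by rewrite assign_cons // assign_cons //= sp.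
split=> [nF|[g Hg] [a /(_ (g [:: a]))]].
- have /choice[r Hr] : forall a, exists bg : M * (seq M -> M),
      forall m, size m = size xy ->
        ~ sat (assign e [:: x, y & pair_vars xy] [:: a, bg.1 & play bg.2 m]) phi.
    move=> a; move/forallNP/(_ a)/existsNP: nF => [b /(IH _ uxy)[g Hg]].
    by exists (b, g) => m sm; rewrite -E //; apply: Hg.
  have [d] := dom_inhabited M.
  (* The first answer to [a] and the later strategy after [a] are glued. [play] consults its
     strategy only at nonempty sequences, so [d] is a mere filler. *)
  exists (fun q => if q is a :: q' then
                     if q' is [::] then (r a).1 else (r a).2 q'
                   else d) => -[//|a m] /= [sm].
  have -> : play (fun q => if q is [::] then (r a).1 else (r a).2 q) m =
            play (r a).2 m.
    by case: m {sm} => //= c m.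
  exact: Hr.
- apply/(IH _ uxy); exists (fun q => g (a :: q)) => m sm.
  by rewrite E //; apply: (Hg (a :: m)); rewrite /= sm.
Qed.

Lemma not_sat_prenex (y0 : var) (xy : seq (var * var)) (e : var -> M) :
  uniq (prefix_vars y0 xy) ->
  ~ sat e (prenex y0 xy phi) <->
  exists g, forall m, size m = size xy ->
    ~ sat (assign e (prefix_vars y0 xy) (g [::] :: play g m)) phi.
Proof.
move=> /=/andP[y0P uxy]; have E d g m : size m = size xy ->
    assign (update e y0 d) (pair_vars xy) (play g m) =
    assign e (prefix_vars y0 xy) (d :: play g m).
  by move=> sm; rewrite assign_cons // size_play size_pair_vars sm.
split=> [/existsNP[d /(not_sat_quantified _ uxy)[g Hg]]|[g Hg] /(_ (g [::]))].
(* The place [[::]], never read by [play], stores the counterexample for [y0]. *)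
- exists (fun q => if q is [::] then d else g q) => m sm.
  have -> : play (fun q => if q is [::] then d else g q) m = play g m.
    by case: m {sm}.
  by rewrite -E //; apply: Hg.
- by apply/(not_sat_quantified _ uxy); exists g => m sm; rewrite E //; apply: Hg.
Qed.

Lemma sat_instance (T : ordered_tree) (z : node T -> var) (t : edge T -> term L)
    (vs : seq var) (b : seq (edge T)) (e : var -> M) : quantifier_free phi ->
  sat e (instance z t vs phi b) <->
  sat (assign e vs [seq teval e s | s <- branch_labels z t b]) phi.
Proof.
move=> qf; rewrite sat_subst //.
suff -> : (fun v => teval e (nth (Var v) (branch_labels z t b) (index v vs))) =
          assign e vs [seq teval e s | s <- branch_labels z t b] by [].
apply/funext => v.
rewrite /assign; case: (ltnP (index v vs) (size (branch_labels z t b))) => lt.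
  by rewrite (nth_map (Var v)).
by rewrite !nth_default ?size_map.
Qed.

End Falsification.

(* Recursion along [prec]: [#|T|] iterations of [F] reach its fixpoint. *)
Lemma prec_fixpoint (T : ordered_tree) (D : Type) (F : (node T -> D) -> node T -> D) :
  inhabited D ->
  (forall h h' u, (forall v, prec v u -> h v = h' v) -> F h u = F h' u) ->
  exists h, forall u, h u = F h u.
Proof.
move=> [d] HF; pose rk u := #|[pred v | @prec T v u]|.
have rk_lt v u : prec v u -> rk v < rk u.
  move=> vu; apply: proper_card; apply/properP; split.
    by apply/fintype.subsetP => w; rewrite !inE => /prec_trans; apply.
  by exists v; rewrite !inE ?prec_irr.
pose W n := iter n F (fun=> d).
have WE n m u : rk u < n -> rk u < m -> W n u = W m u.
  elim: n m u => // n IH [//|m] u un um; apply: HF => v /rk_lt vu.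
  by apply: IH; [apply: leq_trans vu un | apply: leq_trans vu um].
exists (W #|node T|.+1) => u; apply: (@WE _ #|node T|.+2 u).
  by rewrite ltnS max_card.
by rewrite ltnS (leq_trans (max_card _)).
Qed.

(** * Soundness: a winning strategy for Student implies validity *)

Section Soundness.
Variables (L : language) (M : structure L) (T : ordered_tree).
Variables (z : node T -> var) (t : edge T -> term L) (e : var -> M).
Variable g : seq M -> M.
Hypotheses (z_inj : injective z) (tP : strategy z t).

(** Here [h v] stands for the values of Student's moves on the path from the root to [v]. *)
Let val_of (h : node T -> seq M) (x : var) : M :=
  if [pick v | z v == x] is Some v then g (h v) else e x.

Let val_ofE h u : val_of h (z u) = g (h u).
Proof.
rewrite /val_of; case: pickP => [v /eqP/z_inj->//|/(_ u)].
by rewrite eqxx.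
Qed.

Lemma opponent_valuation : exists rho : var -> M, forall b,
  branch b ->
  exists2 m, size m = size b &
    [seq teval rho s | s <- branch_labels z t b] = g [::] :: play g m.
Proof.
(* The history at a node extends that of its parent by the value of the edge label. This value
   depends on histories at earlier nodes, hence the recursion along [prec]. *)
pose F h u := if [pick a | tgt a == u] is Some a
              then rcons (h (src a)) (teval (val_of h) (t a)) else [::].
have [||h hE] := @prec_fixpoint T (seq M) F.
- exact: inhabits [::].
- move=> h h' u H; rewrite /F; case: pickP => // a /eqP au.
  have pa : prec (src a) u by rewrite -au; apply: prec_child; apply: (valP a).
  rewrite H //; congr (rcons _ _); apply: eq_teval => x.
  (* The strategy condition: the variables of [t a] label nodes preceding [tgt a], where [h] and
     [h'] agree. *)
  move=> /(proj1 tP)[v + ->]; rewrite /ext_prec /= andbF orbF au => vu.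
  by rewrite !val_ofE H.
have h_root : h (root T) = [::].
  rewrite hE /F; case: pickP => // a /eqP ra.
  by have := root_no_parent (src a); rewrite -ra (valP a).
have h_tgt a : h (tgt a) = rcons (h (src a)) (teval (val_of h) (t a)).
  rewrite hE {1}/F; case: pickP => [a' /eqP ta|/(_ a)]; last by rewrite eqxx.
  suff -> : a' = a by [].
  apply: val_inj; move: ta (valP a) (valP a'); rewrite /tgt.
  case: (val a) (val a') => [u v] [u' v'] /= -> uv u'v.
  by rewrite (parent_unique uv u'v).
exists (val_of h) => b; rewrite /branch /branch_labels /= val_ofE h_root => bb.
exists [seq teval (val_of h) (t a) | a <- b]; first by rewrite size_map.
congr (_ :: _).
(* Prefixing the history of the starting node makes the induction work for branches from any
   node. *)
have -> : g = (fun q => g (h (root T) ++ q)) by apply/funext => q; rewrite h_root.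
elim: b (root T) bb => //= a b IH u /andP[/eqP au /IH ->].
rewrite val_ofE h_tgt au cats1; congr [:: _, _ & _].
by apply: eq_play => q; rewrite cat_rcons.
Qed.

End Soundness.

Lemma winning_valid (L : language) (y0 : var) (xy : seq (var * var))
    (phi : formula L) (T : ordered_tree) (z : node T -> var) (t : edge T -> term L) :
  uniq (prefix_vars y0 xy) -> quantifier_free phi ->
  {subset fvars phi <= prefix_vars y0 xy} ->
  herbrand_game_tree z t (size xy) ->
  winning z t (size xy) (prefix_vars y0 xy) phi -> valid (prenex y0 xy phi).
Proof.
move=> uxy qf vP [_ zi tP] win M e; apply: contrapT.
move=> /(not_sat_prenex _ _ uxy)[g Hg].
have [rho Hrho] := opponent_valuation e g zi tP.
have := win (fun A => `[< sat rho A >]).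
rewrite peval_big_or => /existsP[b /andP[/Hrho[m sm E]]].
rewrite peval_sat sat_instance // E.
rewrite size_tuple in sm; move: (Hg m sm).
(* The base valuations [e] and [rho] matter only outside the prefix, where [phi] has no
   variables. *)
suff E' : sat (assign e (prefix_vars y0 xy) (g [::] :: play g m)) phi <->
          sat (assign rho (prefix_vars y0 xy) (g [::] :: play g m)) phi.
  by rewrite E'.
apply: eq_sat => // v /vP vP'; apply: set_nth_default.
suff -> : size (g [::] :: play g m) = size (prefix_vars y0 xy) by rewrite index_mem.
by rewrite /= size_play sm -size_pair_vars.
Qed.

(** * The Herbrand universe and its translation into terms of the language *)

Section HerbrandTerms.
Variable L : language.

(* Opponent's answer to the moves [q] of Student is the term [Sk q] itself, as
   in the Herbrand universe of the Skolemized formula. *)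
Inductive hterm : Type :=
| HApp (f : fsym L) of {ffun 'I_(farity f) -> hterm}
| Sk of seq hterm.

(** The function symbols form an arbitrary type, so equality and choice are classical. *)
HB.instance Definition _ := gen_eqMixin hterm.
HB.instance Definition _ := gen_choiceMixin hterm.

Lemma hterm_nested_ind (P : hterm -> Prop) :
  (forall (f : fsym L) (ts : {ffun 'I_(farity f) -> hterm}),
     (forall i, P (ts i)) -> P (HApp ts)) ->
  (forall q, (forall x, x \in q -> P x) -> P (Sk q)) ->
  forall t, P t.
Proof.
move=> PApp PSk; fix IH 1 => -[f ts|q].
  by apply: PApp => i; apply: IH.
apply: PSk; elim: q => [|x q IHq] y; first by discriminate.
rewrite inE => /predU1P[->|/IHq]; last exact.
exact: IH.
Qed.

Fixpoint hsize (t : hterm) : nat :=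
  match t with
  | HApp f ts => (sumn [seq hsize (ts i) | i <- enum 'I_(farity f)]).+1
  | Sk q => (sumn [seq hsize x | x <- q]).+1
  end.

(** The recursion continues below [Sk]: the node for [q] can be reached only through edges labeled
    by the moves in [q], whose own positions are needed too. *)
Fixpoint plays (t : hterm) : seq (seq hterm) :=
  match t with
  | HApp f ts => flatten [seq plays (ts i) | i <- enum 'I_(farity f)]
  | Sk q => q :: flatten [seq plays x | x <- q]
  end.

Fixpoint tau (z : seq hterm -> var) (t : hterm) : term L :=
  match t with
  | HApp f ts => App f [ffun i => tau z (ts i)]
  | Sk q => Var (z q)
  end.

Fixpoint untau (N : seq (seq hterm)) (t : term L) : hterm :=
  match t with
  | Var x => Sk (nth [::] N x)
  | App f ts => HApp [ffun i => untau N (ts i)]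
  end.

Lemma leq_sumn_map (I : eqType) (F : I -> nat) (s : seq I) (x : I) :
  x \in s -> F x <= sumn [seq F y | y <- s].
Proof.
elim: s => // y s IH; rewrite inE => /predU1P[->|/IH le] /=.
  exact: leq_addr.
exact: leq_trans le (leq_addl _ _).
Qed.

(** Ordering positions by size thus puts a node after its parent and after all positions occurring
    in the last move. *)
Lemma hsize_rcons (q : seq hterm) (x : hterm) :
  hsize (Sk q) < hsize (Sk (rcons q x)) /\ hsize x < hsize (Sk (rcons q x)).
Proof.
have x_gt0 : 0 < hsize x by case: (x).
by rewrite /= map_rcons sumn_rcons; lia.
Qed.

Lemma hsize_plays (t : hterm) (q : seq hterm) :
  q \in plays t -> hsize (Sk q) <= hsize t.
Proof.
elim/hterm_nested_ind: t => [f ts IH|p IH].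
  move=> /flatten_mapP[i iP /IH le]; apply: leq_trans le _; apply/ltnW.
  exact: (leq_sumn_map (fun i => hsize (ts i)) iP).
rewrite [plays _]/= inE => /predU1P[->//|/flatten_mapP[x xp /(IH _ xp) le]].
by apply: leq_trans le _; apply/ltnW; exact: (leq_sumn_map hsize xp).
Qed.

Lemma plays_trans (t : hterm) (q : seq hterm) (x : hterm) :
  q \in plays t -> x \in q -> {subset plays x <= plays t}.
Proof.
elim/hterm_nested_ind: t => [f ts IH|p IH].
  move=> /flatten_mapP[i iP qi] xq r rx; apply/flatten_mapP; exists i => //.
  exact: (IH i qi xq).
rewrite [plays (Sk p)]/= inE => /predU1P[->|/flatten_mapP[y yp qy]] xq r rx.
  by rewrite inE; apply/orP; right; apply/flatten_mapP; exists x.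
rewrite inE; apply/orP; right; apply/flatten_mapP; exists y => //.
exact: (IH y yp qy xq).
Qed.

(* Hence distinct outgoing edges of a node get distinct labels. *)
Lemma tauK (N : seq (seq hterm)) (t : hterm) :
  {subset plays t <= N} -> untau N (tau (index^~ N) t) = t.
Proof.
elim/hterm_nested_ind: t => [f ts IH|q _] sub /=.
  congr (HApp _); apply/ffunP => i; rewrite !ffunE IH // => q qi.
  by apply: sub; apply/flatten_mapP; exists i => //; exact: mem_enum.
by rewrite nth_index // sub // mem_head.
Qed.

Lemma tvars_tau (z : seq hterm -> var) (t : hterm) (x : var) :
  x \in tvars (tau z t) -> exists2 q, q \in plays t & x = z q.
Proof.
elim/hterm_nested_ind: t => [f ts IH|q _] /=.
  move=> /flatten_mapP[i iP]; rewrite ffunE => /IH[q qi ->].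
  by exists q => //; apply/flatten_mapP; exists i.
by rewrite inE => /eqP->; exists q; rewrite ?mem_head.
Qed.

End HerbrandTerms.

(** * The Herbrand game tree on a closed finite set of positions *)

Section PlayTree.
Variables (L : language) (k : nat) (N : seq (seq (hterm L))).
Hypothesis nil_N : [::] \in N.
Hypothesis size_N : forall q, q \in N -> size q <= k.
Hypothesis prefix_N : forall q x, rcons q x \in N -> q \in N.
Hypothesis extend_N : forall q, q \in N -> size q < k -> exists x, rcons q x \in N.
Hypothesis plays_N : forall q x, rcons q x \in N -> {subset plays x <= N}.

Let lastx (q : seq (hterm L)) := last (Sk [::]) q.

Definition play_node : finType := seq_sub N.
Definition play_root : play_node := SeqSub nil_N.
Definition play_child : rel play_node :=
  fun u v => val v == rcons (val u) (lastx (val v)).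

Let childP (u v : play_node) :
  reflect (exists x, val v = rcons (val u) x) (play_child u v).
Proof.
apply: (iffP eqP) => [->|[x ->]]; first by exists (lastx (val v)).
by rewrite /lastx last_rcons.
Qed.

Lemma play_root_no_parent u : ~~ play_child u play_root.
Proof. by apply/childP => -[x /esym]; case: (val u). Qed.

Lemma play_parent_unique u v w : play_child u w -> play_child v w -> u = v.
Proof.
move=> /childP[x Ew] /childP[y]; rewrite Ew => /rcons_inj[uv _].
exact: val_inj.
Qed.

Lemma play_root_connected u : connect play_child play_root u.
Proof.
case: u => q; elim/last_ind: q => [|q x IH] qN.
  by rewrite (bool_irrelevance qN nil_N).
apply: connect_trans (IH (prefix_N qN)) (connect1 _).
by apply/childP; exists x.
Qed.

Definition play_rooted : rooted_tree :=
  RootedTree play_root_no_parent play_parent_unique play_root_connected.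

(** Size secures the conditions on children and edge labels; the index in [N] breaks ties to make
    the order total. *)
Definition play_prec : rel play_node := fun u v =>
  (hsize (Sk (val u)) < hsize (Sk (val v))) ||
  (hsize (Sk (val u)) == hsize (Sk (val v))) &&
  (index (val u) N < index (val v) N).

Lemma play_prec_irr : irreflexive play_prec.
Proof. by move=> u; rewrite /play_prec !ltnn andbF. Qed.

Lemma play_prec_trans : transitive play_prec.
Proof. move=> v u w; rewrite /play_prec; lia. Qed.

Lemma play_prec_total u v : u != v -> play_prec u v || play_prec v u.
Proof.
move=> uv; suff : index (val u) N != index (val v) N.
  by rewrite /play_prec; case: ltngtP => //=; case: ltngtP.
apply: contra uv => /eqP E; apply/eqP/val_inj.
by rewrite -(nth_index [::] (valP u)) E nth_index // (valP v).
Qed.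

Lemma play_prec_child u v : play_child u v -> play_prec u v.
Proof.
by move=> /childP[x]; rewrite /play_prec => ->; rewrite (hsize_rcons _ x).1.
Qed.

Definition play_tree : ordered_tree :=
  @OrderedTree play_rooted play_prec play_prec_irr play_prec_trans
    play_prec_total play_prec_child.

Definition play_var (u : node play_tree) : var := index (val (u : play_node)) N.
Definition play_label (a : edge play_tree) : term L :=
  tau (index^~ N) (lastx (val (tgt a : play_node))).

Let edgeP (a : edge play_tree) :
  val (tgt a : play_node) =
  rcons (val (src a : play_node)) (lastx (val (tgt a : play_node))).
Proof. exact/eqP/(valP a). Qed.

Let edge_plays (a : edge play_tree) :
  {subset plays (lastx (val (tgt a : play_node))) <= N}.
Proof.
by apply: (@plays_N (val (src a : play_node))); rewrite -edgeP; apply: valP.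
Qed.

(** Leaves have length [k] because shorter positions extend within [N]; node variables are distinct
    as indices in [N]. *)
Lemma play_game_tree : herbrand_game_tree play_var play_label k.
Proof.
split.
- move=> b; rewrite /branch.
  suff : forall u : play_node,
      @branch_from play_rooted u b -> size (val u) + size b = k.
    by move=> H /H; rewrite add0n.
  elim: b => [|a b IH] u /=.
    move=> /forallP lf; rewrite addn0; apply/eqP.
    rewrite eqn_leq size_N ?(valP u) //=.
    rewrite leqNgt; apply/negP => /(extend_N (valP u))[x xN].
    by have /childP[] := lf (SeqSub xN); exists x.
  move=> /andP[/eqP au /IH <-].
  by rewrite edgeP size_rcons au addSnnS.
- move=> u v E; apply: val_inj.
  by rewrite -(nth_index [::] (valP u)) [index _ _]E nth_index // (valP v).
split=> [a x /tvars_tau[q qt ->]|a a' sa na E].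
- have qN := edge_plays qt; exists (SeqSub qN : node play_tree) => //.
  rewrite /ext_prec /= andbF orbF /play_prec /=; apply/orP; left.
  (* [Sk q] is at most as large as the last move, which is strictly smaller than the term of the
     target node. *)
  apply: leq_ltn_trans (hsize_plays qt) _.
  have [_] := hsize_rcons (val (src a : play_node))
                (lastx (val (tgt a : play_node))).
  by rewrite -edgeP.
- apply: na; apply: val_inj.
  have E' : tgt a = tgt a'.
    apply: val_inj; rewrite (edgeP a) (edgeP a') sa; congr rcons.
    by rewrite -(tauK (@edge_plays a)) [X in untau _ X]E tauK.
  by move: sa E'; rewrite /src /tgt; case: (val a) (val a') => ? ? [? ?] /= -> ->.
Qed.

Let prefix_cat_N q r : q ++ r \in N -> q \in N.
Proof.
by elim/last_ind: r => [|r x IH]; rewrite ?cats0 // -rcons_cat => /prefix_N.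
Qed.

(** The full play [m] is realized by a branch: the node after the moves [q] carries the translation
    of Opponent's answer [Sk q]. *)
Lemma play_branch (m : seq (hterm L)) : m \in N -> size m = k ->
  exists2 b, branch b & branch_labels play_var play_label b =
    [seq tau (index^~ N) t | t <- Sk [::] :: play (@Sk L) m].
Proof.
move=> mN sm; rewrite /branch /branch_labels /=.
suff : forall r (u : play_node), val u ++ r \in N -> size (val u ++ r) = k ->
  exists2 b, @branch_from play_rooted u b &
    flatten [seq [:: play_label a; Var (play_var (tgt a))] | a <- b] =
    [seq tau (index^~ N) t | t <- play (fun q => Sk (val u ++ q)) r].
  by move=> /(_ m play_root mN sm)[b bb E]; exists b; rewrite // E.
elim=> [|x r IH] u uN su.
  exists [::] => //=; apply/forallP => v; apply/negP => /childP[x E].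
  have := size_N (valP v); rewrite E size_rcons; rewrite cats0 in su.
  by rewrite su ltnn.
rewrite -cat_rcons in uN su; pose v : play_node := SeqSub (prefix_cat_N uN).
have [b bv E] := IH v uN su.
have uv : @child play_rooted u v by apply/childP; exists x.
exists (exist _ (u, v) uv :: b); rewrite /= ?/src ?eqxx //= E.
rewrite /play_label /play_var /tgt /= /lastx last_rcons cats1.
congr [:: _, _ & map _ _]; apply: eq_play => q.
by rewrite cat_rcons.
Qed.

End PlayTree.

(** * Closing a finite set of plays under prefixes, extensions and occurring positions *)

Section PlayClosure.
Variables (L : language) (k : nat).
Implicit Types (q r : seq (hterm L)) (s : seq (seq (hterm L))).

(* Excludes the terms [Sk q] with more moves in [q] than the game has rounds. *)
Definition good (t : hterm L) : bool := all (fun q => size q <= k) (plays t).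

Lemma good_HApp (f : fsym L) (ts : {ffun 'I_(farity f) -> hterm L}) :
  (forall i, good (ts i)) -> good (HApp ts).
Proof.
move=> gts; apply/allP => q /flatten_mapP[i _].
exact: (allP (gts i)).
Qed.

Lemma good_Sk q : size q <= k -> all good q -> good (Sk q).
Proof.
move=> sq gq; rewrite /good /= sq; apply/allP => r /flatten_mapP[x xq].
exact: (allP (allP gq x xq)).
Qed.

Let sub_plays s := [::] :: s ++ flatten [seq plays x | x <- flatten s].

(* The padding makes every maximal position have length [k]. *)
Definition play_closure s : seq (seq (hterm L)) :=
  [seq take i (q ++ nseq k (Sk [::])) | q <- sub_plays s, i <- iota 0 k.+1].

Variable s : seq (seq (hterm L)).
Hypothesis size_s : forall q, q \in s -> size q = k.
Hypothesis good_s : forall q, q \in s -> all good q.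

Let closureP r : reflect (exists q i,
  [/\ q \in sub_plays s, i <= k & r = take i (q ++ nseq k (Sk [::]))])
  (r \in play_closure s).
Proof.
apply: (iffP allpairsP) => [[[q i] [qs]]|[q [i [qs ik ->]]]].
  by rewrite mem_iota add0n ltnS => ik ->; exists q, i.
by exists (q, i); split=> //; rewrite mem_iota add0n ltnS.
Qed.

Let size_sub_plays q : q \in sub_plays s -> size q <= k.
Proof.
rewrite inE mem_cat => /orP[/eqP-> //|/orP[/size_s-> //|/flatten_mapP[x]]].
by move=> /flattenP[p /good_s/allP gp /gp/allP gx /gx].
Qed.

Lemma sub_play_closure : {subset sub_plays s <= play_closure s}.
Proof.
move=> q qs; apply/closureP; exists q, (size q).
by split; [|apply: size_sub_plays | rewrite take_size_cat].
Qed.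

Let size_take_pad q i : i <= k -> size (take i (q ++ nseq k (@Sk L [::]))) = i.
Proof. by move=> ik; rewrite size_takel // size_cat size_nseq; lia. Qed.

Lemma nil_play_closure : [::] \in play_closure s.
Proof. by apply: sub_play_closure; rewrite mem_head. Qed.

Lemma mem_play_closure q : q \in s -> q \in play_closure s.
Proof. by move=> qs; apply: sub_play_closure; rewrite inE mem_cat qs orbT. Qed.

Lemma size_play_closure q : q \in play_closure s -> size q <= k.
Proof. by move=> /closureP[p [i [_ ik ->]]]; rewrite size_take_pad. Qed.

Lemma prefix_play_closure q x : rcons q x \in play_closure s -> q \in play_closure s.
Proof.
move=> /closureP[p [i [ps ik E]]]; apply/closureP; exists p, (size q).
have si : (size q).+1 = i by rewrite -(size_take_pad p ik) -E size_rcons.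
split=> //; first by lia.
suff -> : take (size q) (p ++ nseq k (Sk [::])) = take (size q) (rcons q x).
  by rewrite -cats1 take_size_cat.
by rewrite E take_takel // -si.
Qed.

Lemma extend_play_closure q : q \in play_closure s -> size q < k ->
  exists x, rcons q x \in play_closure s.
Proof.
move=> /closureP[p [i [ps ik ->]]]; rewrite size_take_pad // => lt_ik.
exists (nth (Sk [::]) (p ++ nseq k (Sk [::])) i).
rewrite -take_nth; last by rewrite size_cat size_nseq; lia.
by apply/closureP; exists p, i.+1.
Qed.

(** A move is either padding, whose only position is the root, or a move of some [p] in
    [sub_plays s]. When [p] itself occurs inside a move, [plays_trans] shows that one round of
    collecting positions suffices. *)
Lemma plays_play_closure q x : rcons q x \in play_closure s ->
  {subset plays x <= play_closure s}.
Proof.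
move=> /closureP[p [i [ps ik E]]] r rx.
have : x \in p ++ nseq k (Sk [::]).
  by apply: (@mem_take i); rewrite -E mem_rcons mem_head.
rewrite mem_cat mem_nseq => /orP[xp|/andP[_ /eqP xE]]; last first.
  by move: rx; rewrite xE inE => /eqP->; apply: nil_play_closure.
apply: sub_play_closure; rewrite inE mem_cat.
apply/orP; right; apply/orP; right.
move: ps; rewrite inE mem_cat => /orP[/eqP pE|/orP[ps|]].
- by rewrite pE in xp.
- by apply/flatten_mapP; exists x => //; apply/flattenP; exists p.
move=> /flatten_mapP[y ys py]; apply/flatten_mapP; exists y => //.
exact: (plays_trans py xp).
Qed.

End PlayClosure.

Lemma eq_subst (L : language) (F : formula L) (s s' : var -> term L) :
  quantifier_free F -> {in fvars F, s =1 s'} -> subst s F = subst s' F.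
Proof.
have eq_tsubst t : {in tvars t, s =1 s'} -> tsubst s t = tsubst s' t.
  elim/term_nested_ind: t => [x|f ts IH] /= H; first by apply: H; rewrite inE.
  congr (App _ _); apply/ffunP => i; rewrite !ffunE; apply: IH => x xi.
  by apply: H; apply/flatten_mapP; exists i; rewrite ?mem_enum.
elim: F => //=.
- move=> r ts _ H; congr (Rel _ _); apply/ffunP => i; rewrite !ffunE.
  apply: eq_tsubst => x xi.
  by apply: H; apply/flatten_mapP; exists i; rewrite ?mem_enum.
- by move=> A IH qA H; rewrite IH.
- move=> A IHA B IHB /andP[qA qB] H.
  by rewrite IHA ?IHB // => x xP; apply: H; rewrite mem_cat xP ?orbT.
- move=> A IHA B IHB /andP[qA qB] H.
  by rewrite IHA ?IHB // => x xP; apply: H; rewrite mem_cat xP ?orbT.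
- move=> A IHA B IHB /andP[qA qB] H.
  by rewrite IHA ?IHB // => x xP; apply: H; rewrite mem_cat xP ?orbT.
Qed.

(** The length bound matters: [answer] is only known to agree with [Sk] on at most [k] moves. *)
Lemma map_play (D D' : Type) (F : D -> D') (g : seq D -> D) (g' : seq D' -> D')
    (m : seq D) :
  (forall q, size q <= size m -> F (g q) = g' (map F q)) ->
  map F (play g m) = play g' (map F m).
Proof.
elim: m g g' => //= a m IH g g' H; rewrite H // (IH _ (fun q => g' (F a :: q))) //.
by move=> q qm; rewrite H.
Qed.

(** * The limit of truth assignments along an ultrafilter *)

Section Limit.
Local Open Scope classical_set_scope.
Variables (L : language) (k : nat).

Definition ghterm : Type := {t : hterm L | good k t}.

Definition ghterm_root : ghterm :=
  exist _ (Sk [::]) (@good_Sk L k [::] (leq0n k) isT).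

Definition ghterm_app (f : fsym L) (ts : {ffun 'I_(farity f) -> ghterm}) : ghterm :=
  exist _ (HApp [ffun i => val (ts i)])
    (@good_HApp L k f [ffun i => val (ts i)]
       (fun i => eq_ind_r (fun t => good k t) (valP (ts i)) (ffunE _ i))).

(** The default [ghterm_root] is taken only for more than [k] moves, when the Skolem term is not
    good. *)
Definition answer (q : seq ghterm) : ghterm :=
  insubd ghterm_root (Sk (map val q)).

Lemma val_answer q : size q <= k -> val (answer q) = Sk (map val q).
Proof.
move=> sq; apply: insubdK; apply: good_Sk; first by rewrite size_map.
by apply/allP => _ /mapP[x _ ->]; apply: valP.
Qed.

Variables (I : Type) (U : set_system I) (z : I -> seq (hterm L) -> var).
Variable v : I -> formula L -> bool.

(** The domain is fixed and not an ultraproduct; only the truth of atoms is decided by [U], each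
    index [i] naming positions by its own variables [z i]. *)
Definition limit_structure : structure L :=
  @Structure L ghterm (inhabits ghterm_root) ghterm_app
    (fun r ts => U [set i | v i (Rel r [ffun j => tau (z i) (val (ts j))])]).

Lemma tau_teval (e : var -> limit_structure) (t : term L) (i : I) :
  tau (z i) (val (teval e t : ghterm)) =
  tsubst (fun x => tau (z i) (val (e x : ghterm))) t.
Proof.
elim/term_nested_ind: t => //= f ts IH; congr (App _ _).
by apply/ffunP => j; rewrite !ffunE IH.
Qed.

(** The quantifier-free case of the theorem of Los: atoms agree by definition of the structure, and
    an ultrafilter commutes with the connectives. *)
Lemma sat_limit (e : var -> limit_structure) (F : formula L) :
  UltraFilter U -> quantifier_free F ->
  sat e F <->
  U [set i | peval (v i) (subst (fun x => tau (z i) (val (e x : ghterm))) F)].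
Proof.
move=> UU; have UC A : ~ U A <-> U (~` A).
  split=> [nA|UnA UA]; first by case: (in_ultra_setVsetC A UU).
  by apply: (filter_not_empty U); rewrite -(setICr A); apply: filterI.
have UD A B : U (A `|` B) <-> U A \/ U B.
  split=> [UAB|[]]; last 2 first.
  - by apply: filterS => i; left.
  - by apply: filterS => i; right.
  apply: contrapT => /not_orP[/UC UA /UC UB]; apply: (filter_not_empty U).
  by apply: filterS (filterI (filterI UA UB) UAB) => i [[nA nB] []].
elim: F => //=.
- split=> //; have -> : [set _ | false] = set0 :> set I by apply/seteqP; split.
  exact: (filter_not_empty U).
- move=> r ts _.
  set A := [set i | _]; set B := [set i | _]; suff -> : A = B by [].
  have E i : [ffun j => tau (z i) (val (([ffun j => teval e (ts j)] j) : ghterm))] =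
    [ffun j => tsubst (fun x => tau (z i) (val (e x : ghterm))) (ts j)].
    by apply/ffunP => j; rewrite !ffunE tau_teval.
  by apply/seteqP; split => i; rewrite /A /B /= E.
- move=> A IH /IH->; rewrite UC; set B := (~` _); set C := [set i | _].
  by suff -> : B = C by []; apply/seteqP; split => i /negP.
- move=> A IHA B IHB /andP[/IHA-> /IHB->]; split=> [[UA UB]|UAB].
    by apply: filterS (filterI UA UB) => i [/= -> ->].
  by split; apply: filterS UAB => i /andP[].
- move=> A IHA B IHB /andP[/IHA-> /IHB->]; rewrite -UD.
  set C := (_ `|` _); set D := [set i | _].
  by suff -> : C = D by []; apply/seteqP; split => i /orP.
- move=> A IHA B IHB /andP[/IHA-> /IHB->]; rewrite implyE UC -UD.
  set C := (_ `|` _); set D := [set i | _].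
  suff -> : C = D by []; apply/seteqP; split => i; rewrite /C /D /=.
    by case=> [/negP/negPf->|->]; rewrite ?implybT.
  by case: (peval _ _) => /= [->|_]; [right|left].
Qed.

End Limit.

(** * Completeness: from the absence of winning trees to a countermodel *)

Section LosingAssignment.
Variables (L : language) (k : nat) (s : seq (k.-tuple (ghterm L k))).

Definition play_nodes : seq (seq (hterm L)) :=
  play_closure k [seq map val (tval p) | p <- s].

Let size_moves q : q \in [seq map val (tval p) | p <- s] -> size q = k.
Proof. by move=> /mapP[p _ ->]; rewrite size_map size_tuple. Qed.

Let good_moves q : q \in [seq map val (tval p) | p <- s] -> all (good k) q.
Proof. by move=> /mapP[p _ ->]; apply/allP => _ /mapP[x _ ->]; apply: valP. Qed.

Lemma mem_play_nodes (p : k.-tuple (ghterm L k)) :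
  p \in s -> map val (tval p) \in play_nodes.
Proof. by move=> ps; apply: mem_play_closure => //; apply/mapP; exists p. Qed.

(** An assignment refuting the disjunction for the tree on [play_nodes] refutes every branch, and
    each full-length position there is a branch. *)
Lemma losing_assignment (vs : seq var) (phi : formula L) :
  ~ (exists (T : ordered_tree) (z : node T -> var) (t : edge T -> term L),
       herbrand_game_tree z t k /\ winning z t k vs phi) ->
  exists v : formula L -> bool, forall m, m \in play_nodes -> size m = k ->
    ~~ peval v (subst (fun x => nth (Var x)
         [seq tau (index^~ play_nodes) t | t <- Sk [::] :: play (@Sk L) m]
         (index x vs)) phi).
Proof.
move=> no_tree; have N0 := nil_play_closure size_moves good_moves.
have Nsz := @size_play_closure _ k [seq map val (tval p) | p <- s].
have Npre := @prefix_play_closure _ k [seq map val (tval p) | p <- s].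
have Next := @extend_play_closure _ k [seq map val (tval p) | p <- s].
have Nplays := plays_play_closure size_moves good_moves.
have game := play_game_tree N0 Nsz Npre Next Nplays.
have /existsNP[v /negP nv] : ~ winning (play_var (prefix_N := Npre))
    (play_label (nil_N := N0) (prefix_N := Npre)) k vs phi.
  by move=> win; apply: no_tree; do 3 eexists; split; [exact: game | exact: win].
exists v => m mN sm; have [b bb E] := play_branch N0 Nsz Npre mN sm.
have sb : size b == k by case: game => /(_ b bb) -> _ _.
apply: contra nv => bv; rewrite peval_big_or; apply/existsP; exists (Tuple sb).
by rewrite bb /= /instance E.
Qed.

End LosingAssignment.

Lemma valid_winning (L : language) (k : nat) (y0 : var)
    (xy : k.-tuple (var * var)) (phi : formula L) :
  uniq (prefix_vars y0 xy) -> quantifier_free phi ->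
  {subset fvars phi <= prefix_vars y0 xy} -> valid (prenex y0 xy phi) ->
  exists (T : ordered_tree) (z : node T -> var) (t : edge T -> term L),
    herbrand_game_tree z t k /\ winning z t k (prefix_vars y0 xy) phi.
Proof.
move=> uxy qf vP val_phi; apply: contrapT => no_tree.
pose I := seq (k.-tuple (ghterm L k)).
have /choice[v vE] := fun s : I => losing_assignment s no_tree.
(* The filter of sets containing all sufficiently large finite collections of plays; it is proper
   since [s0] lies in each set that it generates. *)
pose F : set_system I := fun A =>
  exists s0 : I, forall s : I, {subset s0 <= s} -> A s.
have FP : ProperFilter F.
  split; first by move=> [s0 /(_ s0)]; apply.
  split.
  - by exists [::].
  - move=> A B [a aA] [b bB]; exists (a ++ b) => s sub; split.
      by apply: aA => x xa; apply: sub; rewrite mem_cat xa.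
    by apply: bB => x xb; apply: sub; rewrite mem_cat xb orbT.
  - by move=> A B AB [a aA]; exists a => s /aA /AB.
have [U [UU FU]] := ultraFilterLemma FP.
pose z (s : I) := index^~ (play_nodes s).
pose M := limit_structure k U z v.
suff : ~ sat (fun=> ghterm_root L k : M) (prenex y0 xy phi).
  by apply; apply: val_phi.
apply/(not_sat_prenex _ _ uxy); exists (@answer L k) => m sm.
rewrite size_tuple in sm; move/(sat_limit _ UU qf) => Usat.
pose p : k.-tuple (ghterm L k) := Tuple (introT eqP sm).
have Up : U [set s | p \in s]%classic.
  by apply: FU; exists [:: p] => s; apply; rewrite mem_head.
(* If [phi] held on the play [p], some [s] containing [p] would have its instance true under [v s],
   although [v s] falsifies all branches of its tree. *)
have [s [ps /=]] := filter_ex (filterI Up Usat); apply/negP.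
have mN : map val m \in play_nodes s := mem_play_nodes ps.
have := vE s _ mN; rewrite size_map => /(_ sm).
congr (~~ peval _ _); apply: eq_subst => // x /vP xP.
have -> : Sk [::] :: play (@Sk L) (map val m) =
          map val (answer (k := k) [::] :: play (@answer L k) m).
  rewrite /= val_answer // (@map_play _ _ val _ (@Sk L)) // => q qm.
  by rewrite val_answer // (leq_trans qm) ?sm.
have size_labels : size (answer (k := k) [::] :: play (@answer L k) m) =
                   size (prefix_vars y0 xy).
  by rewrite /= size_play -/(pair_vars xy) size_pair_vars sm size_tuple.
by rewrite -map_comp (nth_map (ghterm_root L k)) ?size_labels ?index_mem.
Qed.

Theorem theorem2p5 (L : language) (k : nat) (y0 : var)
    (xy : k.-tuple (var * var)) (phi : formula L)
    (vars_distinct : uniq (prefix_vars y0 xy))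
    (phi_qf : quantifier_free phi)
    (phi_vars : {subset fvars phi <= prefix_vars y0 xy}) :
  valid (prenex y0 xy phi) <->
  exists (T : ordered_tree) (z : node T -> var) (t : edge T -> term L),
    herbrand_game_tree z t k /\ winning z t k (prefix_vars y0 xy) phi.
Proof.
split; first exact: valid_winning.
move=> [T [z [t []]]]; rewrite -{1 2}(size_tuple xy).
exact: winning_valid.
Qed.
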